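(* Let $\alpha,\beta,N\geq 1$ be integers with $\gcd(\beta,N)=1$. Let $(X,0)\subset(\mathbb{C}^3,0)$ be the toric hypersurface singularity with normalization map given by $$\eta:(\mathbb{C}^2,0)\to(X,0),\qquad (u,v)\mapsto(u,\;u^\alpha v^\beta,\;v^N).$$ Let $T\subset\mathbb{N}$ be the numerical semigroup generated by $\{N,\beta\}$, and let $T^s\subset\mathbb{N}$ be its saturation. Then a monomial $u^av^b\in\mathbb{C}\{u,v\}$ is in the Lipschitz saturation $\mathcal{O}_{X,0}^s$ if and only if either $b=mN$ for some $m\in\mathbb{N}$, or ($a\geq\alpha$ and $b\in T^s$).
   Context: $\mathbb{N}=\{0,1,2,\dots\}$. The germ $(X,0)$ is the germ at the origin of the hypersurface $y^N-x^{\alpha N}z^\beta=0$ in $\mathbb{C}^3$ with coordinates $(x,y,z)$; it is the toric surface singularity with semigroup generated by $(1,0),(\alpha,\beta),(0,N)$, and via $\eta$ one has $\mathcal{O}_{X,0}=\mathbb{C}\{u,u^\alpha v^\beta,v^N\}\subset\overline{\mathcal{O}_{X,0}}=\mathbb{C}\{u,v\}$. **Saturation of a numerical semigroup.** A numerical semigroup $S\subset\mathbb{N}$ is saturated if, whenever $s,s_1,\dots,s_r\in S$ with $s_i\le s$ for all $i$ and $z_1,\dots,z_r\in\mathbb{Z}$ satisfy $z_1s_1+\cdots+z_rs_r\ge 0$, then $s+z_1s_1+\cdots+z_rs_r\in S$. The saturation $T^s$ of $T$ is the smallest saturated numerical semigroup containing $T$. For $T$ generated by the coprime integers $N,\beta$,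 put $\beta_0=\min\{N,\beta\}$ and $\beta_1=\max\{N,\beta\}$; then the algorithm computing the saturation gives $T^s=\beta_0\cdot\mathbb{N}\cup\{\beta_1+k : k\in\mathbb{N}\}$. **Lipschitz saturation.** Let $(X,0)$ be a reduced irreducible germ of complex analytic space. Let $\overline{\mathcal{O}_{X,0}}$ be the integral closure of $\mathcal{O}_{X,0}$ in its field of fractions; it is the analytic algebra of the normalization $n:(\overline{X},0)\to(X,0)$. Let $I_\Delta$ be the kernel of the natural surjection $\mathcal{O}_{\overline{X}\times\overline{X},(0,0)}\to\mathcal{O}_{\overline{X}\times_X\overline{X},(0,0)}$. (If $(X,0)\subset(\mathbb{C}^k,0)$ and $n=(\eta_1,\dots,\eta_k)$, then $I_\Delta$ is generated by $\eta_i(x)-\eta_i(y)$, $i=1,\dots,k$; in the present case $I_\Delta=\langle x_1-y_1,\;x_1^\alpha x_2^\beta-y_1^\alpha y_2^\beta,\;x_2^N-y_2^N\rangle\subset\mathbb{C}\{x_1,x_2,y_1,y_2\}$.) For an ideal $I$, $\overline{I}$ denotes its integral closure. The Lipschitz saturation of $\mathcal{O}_{X,0}$ is $$\mathcal{O}_{X,0}^s=\{f\in\overline{\mathcal{O}_{X,0}} : f(x)-f(y)\in\overline{I_\Delta}\}.$$ *)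

(* Defs.v *)
From HB Require Import structures.
From mathcomp Require Import all_boot all_order all_algebra.
From mathcomp Require Import boolp classical_sets.
From mathcomp Require Import mpoly.

Set Implicit Arguments.
Unset Strict Implicit.
Unset Printing Implicit Defensive.

Import Order.TTheory GRing.Theory Num.Theory.

Local Open Scope ring_scope.
Local Open Scope classical_set_scope.

Record fps (n : nat) (K : Type) := Fps { fcoef : 'X_{1..n} -> K }.

HB.instance Definition _ n (K : eqType) := gen_eqMixin (fps n K).
HB.instance Definition _ n (K : choiceType) := gen_choiceMixin (fps n K).

Lemma fpsP n K (f g : fps n K) : (forall m, fcoef f m = fcoef g m) <-> f = g.
Proof.
split=> [|->//]; case: f g => [f] [g] /= fg.
by congr Fps; apply/funext.
Qed.

Section FpsZmod.
Variables (n : nat) (K : zmodType).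
Implicit Types f g h : fps n K.

Definition fps0 : fps n K := Fps (fun=> 0).
Definition fps_opp f : fps n K := Fps (fun m => - fcoef f m).
Definition fps_add f g : fps n K := Fps (fun m => fcoef f m + fcoef g m).

Fact fps_addA : associative fps_add.
Proof. by move=> f g h; apply/fpsP => m /=; rewrite addrA. Qed.
Fact fps_addC : commutative fps_add.
Proof. by move=> f g; apply/fpsP => m /=; rewrite addrC. Qed.
Fact fps_add0 : left_id fps0 fps_add.
Proof. by move=> f; apply/fpsP => m /=; rewrite add0r. Qed.
Fact fps_addN : left_inverse fps0 fps_opp fps_add.
Proof. by move=> f; apply/fpsP => m /=; rewrite addNr. Qed.

HB.instance Definition _ := GRing.isZmodule.Build (fps n K)
  fps_addA fps_addC fps_add0 fps_addN.

Lemma fcoef0 m : fcoef (0 : fps n K) m = 0. Proof. by []. Qed.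
Lemma fcoefD f g m : fcoef (f + g) m = fcoef f m + fcoef g m.
Proof. by []. Qed.
Lemma fcoefN f m : fcoef (- f) m = - fcoef f m. Proof. by []. Qed.
End FpsZmod.

Section FpsRing.
Variables (n : nat) (K : comNzRingType).
Implicit Types f g h : fps n K.
Implicit Types p q : {mpoly K[n]}.

Definition fps_monom (m0 : 'X_{1..n}) : fps n K := Fps (fun m => (m == m0)%:R).

Definition fps_mul f g : fps n K := Fps (fun m =>
  \sum_(k : 'X_{1..n < (mdeg m).+1, (mdeg m).+1} | m == (k.1 + k.2)%MM)
     fcoef f k.1 * fcoef g k.2).

Definition fps_trunc (d : nat) f : {mpoly K[n]} :=
  \sum_(m : 'X_{1..n < d}) fcoef f m *: 'X_[m].

Lemma mcoeff_trunc d f m : (mdeg m < d)%N -> (fps_trunc d f)@_m = fcoef f m.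
Proof. by move=> md; rewrite mcoeff_mpoly. Qed.

Lemma mcoeffM_eq d p p' q q' :
  (forall m, (mdeg m < d)%N -> p@_m = p'@_m) ->
  (forall m, (mdeg m < d)%N -> q@_m = q'@_m) ->
  forall m, (mdeg m < d)%N -> (p * q)@_m = (p' * q')@_m.
Proof.
move=> pp' qq' m md; rewrite !(mcoeff_poly_mul _ _ md).
by apply: eq_bigr => -[k1 k2] _ /=; rewrite pp' ?qq' ?bmdeg.
Qed.

Lemma fps_mulE d f g m : (mdeg m < d)%N ->
  fcoef (fps_mul f g) m = (fps_trunc d f * fps_trunc d g)@_m.
Proof.
move=> md; rewrite [RHS](mcoeff_poly_mul _ _ (ltnSn (mdeg m))) /=.
apply: eq_bigr => -[k1 k2] _ /=.
by rewrite !mcoeff_trunc // (leq_trans (bmdeg _)).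
Qed.

Lemma fps_mul_wide d f g m : (mdeg m < d)%N ->
  fcoef (fps_mul f g) m =
  \sum_(k : 'X_{1..n < d, d} | m == (k.1 + k.2)%MM)
     fcoef f k.1 * fcoef g k.2.
Proof.
move=> md; rewrite (fps_mulE _ _ md) (mcoeff_poly_mul _ _ md).
by apply: eq_bigr => -[k1 k2] _ /=; rewrite !mcoeff_trunc ?bmdeg.
Qed.

Fact fps_mulC : commutative fps_mul.
Proof. by move=> f g; apply/fpsP => m; rewrite !(fps_mulE _ _ (ltnSn _)) mulrC. Qed.

Fact fps_mulA : associative fps_mul.
Proof.
move=> f g h; apply/fpsP => m; set d := (mdeg m).+1.
have md : (mdeg m < d)%N by [].
rewrite !(fps_mulE _ _ md).
have E f1 f2 k : (mdeg k < d)%N ->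
    (fps_trunc d (fps_mul f1 f2))@_k = (fps_trunc d f1 * fps_trunc d f2)@_k.
  by move=> kd; rewrite mcoeff_trunc // (fps_mulE _ _ kd).
rewrite (mcoeffM_eq (p' := fps_trunc d f) _ (E g h) md) //.
by rewrite [RHS](mcoeffM_eq (q' := fps_trunc d h) (E f g) _ md) // mulrA.
Qed.

Fact fps_mul1 : left_id (fps_monom 0%MM) fps_mul.
Proof.
move=> f; apply/fpsP => m; set d := (mdeg m).+1.
have md : (mdeg m < d)%N by [].
rewrite (fps_mulE _ _ md).
rewrite (mcoeffM_eq (p' := 1) (q' := fps_trunc d f) (d := d)) //.
  by rewrite mul1r mcoeff_trunc.
by move=> k kd; rewrite mcoeff_trunc //= mcoeff1.
Qed.

Fact fps_mulDl : left_distributive fps_mul +%R.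
Proof.
move=> f g h; apply/fpsP => m; rewrite fcoefD /= -big_split /=.
by apply: eq_bigr => k _; rewrite mulrDl.
Qed.

Fact fps_1neq0 : fps_monom 0%MM != 0.
Proof.
apply/eqP => /(congr1 (fun f => fcoef f 0%MM)) /=.
by rewrite eqxx => /eqP; rewrite oner_eq0.
Qed.

HB.instance Definition _ := GRing.Zmodule_isComNzRing.Build (fps n K)
  fps_mulA fps_mulC fps_mul1 fps_mulDl fps_1neq0.

Lemma fcoefM_wide d f g m : (mdeg m < d)%N ->
  fcoef (f * g) m =
  \sum_(k : 'X_{1..n < d, d} | m == (k.1 + k.2)%MM)
     fcoef f k.1 * fcoef g k.2.
Proof. exact: fps_mul_wide. Qed.

End FpsRing.

Section Convergent.
Variables (n : nat) (K : numFieldType).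
Implicit Types f g : fps n K.

Definition abs_psum f (r : K) (d : nat) : K :=
  \sum_(m : 'X_{1..n < d}) `|fcoef f m| * r ^+ mdeg m.

(* Absolute convergence on a closed polydisc of positive radius; when [K] is
   [R[i]], [0 < r] forces [r] to be real. *)
Definition fps_convergent f : Prop :=
  exists r : K, 0 < r /\ exists B : K, forall d, abs_psum f r d <= B.

Definition convergent : {pred fps n K} := fun f => `[< fps_convergent f >].

Lemma abs_psum_ge0 f r d : 0 <= r -> 0 <= abs_psum f r d.
Proof. by move=> r0; apply: sumr_ge0 => m _; rewrite mulr_ge0 ?exprn_ge0. Qed.

Lemma abs_psum_le f r s d : 0 <= r -> r <= s -> abs_psum f r d <= abs_psum f s d.
Proof.
move=> r0 rs; apply: ler_sum => m _; apply: ler_wpM2l => //.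
by rewrite lerXn2r // nnegrE // (le_trans r0).
Qed.

Lemma convergent2 f g : fps_convergent f -> fps_convergent g ->
  exists r : K, 0 < r /\ exists B1 B2 : K,
    forall d, abs_psum f r d <= B1 /\ abs_psum g r d <= B2.
Proof.
move=> [r [r0 [B1 fB]]] [s [s0 [B2 gB]]].
have [rs|sr] := real_leP (gtr0_real r0) (gtr0_real s0).
  exists r; split=> //; exists B1, B2 => d; split=> //.
  exact: le_trans (abs_psum_le _ _ (ltW r0) rs) (gB d).
exists s; split=> //; exists B1, B2 => d; split=> //.
exact: le_trans (abs_psum_le _ _ (ltW s0) (ltW sr)) (fB d).
Qed.

Lemma convergent_monom m0 : fps_monom K m0 \in convergent.
Proof.
apply/asboolP; exists 1; split; first exact: ltr01.
exists 1 => d; rewrite /abs_psum.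
have [md|md] := ltnP (mdeg m0) d.
  rewrite (bigD1 (BMultinom md)) //= eqxx normr1 expr1n mulr1 big1 ?addr0 //.
  move=> m /eqP mm0.
  have -> : ((m : 'X_{1..n}) == m0) = false.
    by apply/eqP => E; apply: mm0; apply: val_inj.
  by rewrite normr0 mul0r.
rewrite big1 ?ler01 // => m _ /=.
have -> : ((m : 'X_{1..n}) == m0) = false.
  by apply/eqP => mm0; move: (bmdeg m); rewrite mm0 ltnNge md.
by rewrite normr0 mul0r.
Qed.

Fact convergent_subring : subring_closed convergent.
Proof.
split=> [|f g /asboolP cf /asboolP cg|f g /asboolP cf /asboolP cg].
- exact: convergent_monom.
- have [r [r0 [B1 [B2 B]]]] := convergent2 cf cg.
  apply/asboolP; exists r; split=> //; exists (B1 + B2) => d.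
  have [f1 g1] := B d; apply: le_trans (lerD f1 g1).
  rewrite /abs_psum -big_split /=; apply: ler_sum => m _.
  rewrite -mulrDl; apply: ler_wpM2r; first by rewrite exprn_ge0 ?ltW.
  exact: ler_normB.
- have [r [r0 [B1 [B2 B]]]] := convergent2 cf cg.
  apply/asboolP; exists r; split=> //; exists (B1 * B2) => d.
  have [f1 g1] := B d; have r0' := ltW r0.
  apply: le_trans (ler_pM (abs_psum_ge0 _ _ r0') (abs_psum_ge0 _ _ r0') f1 g1).
  rewrite {2 3}/abs_psum big_distrlr /= pair_big /=.
  have le1 (m : 'X_{1..n < d}) : `|fcoef (f * g) m| * r ^+ mdeg m <=
    \sum_(k : 'X_{1..n < d, d} | (m : 'X_{1..n}) == (k.1 + k.2)%MM)
      (`|fcoef f k.1| * r ^+ mdeg k.1) * (`|fcoef g k.2| * r ^+ mdeg k.2).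
    rewrite (fcoefM_wide _ _ (bmdeg m)).
    apply: (le_trans (ler_wpM2r _ (ler_norm_sum _ _ _))); first exact: exprn_ge0.
    rewrite mulr_suml; apply: ler_sum => k /eqP ->.
    by rewrite normrM mdegD exprD mulrACA.
  apply: (le_trans (ler_sum _ (fun m _ => le1 m))).
  rewrite (exchange_big_dep predT) //=; apply: ler_sum => k _.
  have t0 : 0 <= `|fcoef f k.1| * r ^+ mdeg k.1 * (`|fcoef g k.2| * r ^+ mdeg k.2).
    by rewrite !mulr_ge0 ?exprn_ge0.
  have [kd|kd] := ltnP (mdeg (k.1 + k.2)%MM) d.
    by rewrite (big_pred1 (BMultinom kd)) // => m; rewrite -val_eqE.
  rewrite big_pred0 // => m; apply/eqP => mk.
  by move: (bmdeg m); rewrite mk ltnNge kd.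
Qed.

HB.instance Definition _ := GRing.isSubringClosed.Build (fps n K) convergent
  convergent_subring.

End Convergent.

Record cvps (n : nat) (K : numFieldType) :=
  Cvps { cvps_val : fps n K; _ : cvps_val \in @convergent n K }.

HB.instance Definition _ n K := [isSub for @cvps_val n K].
HB.instance Definition _ n K := [Choice of cvps n K by <:].
HB.instance Definition _ n K := [SubChoice_isSubComNzRing of cvps n K by <:].

Definition cvpsX (n : nat) (K : numFieldType) (i : 'I_n) : cvps n K :=
  Cvps (convergent_monom K U_(i)%MM).
Arguments cvpsX {n K} i.

(* [cvps_rename] sends [f(x_1, .., x_n)] to [f(x_(sigma 1), .., x_(sigma n))]. *)

Section Rename.
Variables (n p : nat) (K : numFieldType) (sigma : 'I_n -> 'I_p).
Variable sigma_inj : injective sigma.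

Definition mnm_restrict (m : 'X_{1..p}) : 'X_{1..n} :=
  [multinom m (sigma i) | i < n].

Definition mnm_supported (m : 'X_{1..p}) : bool :=
  [forall j, (m j != 0%N) ==> (j \in codom sigma)].

Definition fps_rename (f : fps n K) : fps p K := Fps (fun m =>
  if mnm_supported m then fcoef f (mnm_restrict m) else 0).

Lemma mdeg_restrict m : mnm_supported m -> mdeg (mnm_restrict m) = mdeg m.
Proof.
move=> /forallP ms; rewrite !mdegE.
rewrite (bigID (mem (codom sigma))) /= [X in (_ + X)%N]big1 ?addn0; last first.
  by move=> j; apply: contraNeq => mj; exact: (implyP (ms j)).
rewrite -big_uniq /=; last by rewrite map_inj_uniq ?enum_uniq.
by rewrite big_map big_enum /=; apply: eq_bigr => i _; rewrite mnmE.
Qed.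

Lemma mnm_restrict_inj m1 m2 : mnm_supported m1 -> mnm_supported m2 ->
  mnm_restrict m1 = mnm_restrict m2 -> m1 = m2.
Proof.
move=> /forallP s1 /forallP s2 /mnmP E; apply/mnmP => j.
have [/codomP[i ->]|jn] := boolP (j \in codom sigma).
  by have := E i; rewrite !mnmE.
have H (m : 'X_{1..p}) :
    (m j != 0%N) ==> (j \in codom sigma) -> m j = 0%N.
  by rewrite (negPf jn) implybF negbK => /eqP.
by rewrite (H m1 (s1 j)) (H m2 (s2 j)).
Qed.

Lemma convergent_rename f : f \in @convergent n K -> fps_rename f \in @convergent p K.
Proof.
move=> /asboolP[r [r0 [B fB]]]; apply/asboolP.
exists r; split=> //; exists B => d; apply: le_trans (fB d).
pose F (k : 'X_{1..n}) := `|fcoef f k| * r ^+ mdeg k.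
have F0 k : 0 <= F k by rewrite mulr_ge0 // exprn_ge0 // ltW.
rewrite /abs_psum (bigID (fun m : 'X_{1..p < d} => mnm_supported m)) /=.
rewrite [X in _ + X]big1 ?addr0; last first.
  by move=> m /negPf ->; rewrite normr0 mul0r.
have le1 (m : 'X_{1..p < d}) : mnm_supported m ->
    `|if mnm_supported m then fcoef f (mnm_restrict m) else 0| * r ^+ mdeg m <=
    \sum_(k : 'X_{1..n < d} | (k : 'X_{1..n}) == mnm_restrict m) F k.
  move=> ms; have rd : (mdeg (mnm_restrict m) < d)%N by rewrite mdeg_restrict ?bmdeg.
  rewrite (big_pred1 (BMultinom rd)); last by move=> k; rewrite -val_eqE.
  by rewrite ms /F /= mdeg_restrict.
apply: (le_trans (ler_sum _ le1)).
rewrite (exchange_big_dep predT) //=; apply: ler_sum => k _.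
case: (pickP (fun m : 'X_{1..p < d} =>
  mnm_supported m && ((k : 'X_{1..n}) == mnm_restrict m))) => [m0|k0].
  move=> /andP[s0 /eqP k0]; rewrite (big_pred1 m0) // => m /=.
  apply/andP/eqP => [[sm /eqP km]|->]; last by rewrite s0 k0.
  by apply: val_inj; apply: mnm_restrict_inj => //; rewrite -km.
by rewrite big_pred0 //; exact: F0.
Qed.

Definition cvps_rename (f : cvps n K) : cvps p K :=
  Cvps (convergent_rename (valP f)).

End Rename.

(* The first [n] variables of [K{x, y}] are [x], the last [n] are [y]. *)

Definition in_x (n : nat) (K : numFieldType) (f : cvps n K) : cvps (n + n) K :=
  cvps_rename (@lshift_inj n n) f.

Definition in_y (n : nat) (K : numFieldType) (f : cvps n K) : cvps (n + n) K :=
  cvps_rename (@rshift_inj n n) f.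

Section Ideals.
Variable A : comNzRingType.
Implicit Types (S I : set A) (f : A).

Definition ideal_span S : set A := [set f |
  exists (k : nat) (c s : 'I_k -> A),
    (forall i, S (s i)) /\ f = \sum_(i < k) c i * s i].

Definition ideal_power I (j : nat) : set A :=
  ideal_span [set f | exists g : 'I_j -> A,
    (forall i, I (g i)) /\ f = \prod_(i < j) g i].

(* [f ^ k + a_1 f ^ (k - 1) + .. + a_k = 0] with [a_j] in [I ^ j];
   [a_j] is [a (j - 1)] below. *)
Definition ideal_integral_closure I : set A := [set f |
  exists (k : nat) (a : 'I_k -> A), [/\ (0 < k)%N,
    forall j : 'I_k, ideal_power I j.+1 (a j) &
    f ^+ k + \sum_(j < k) a j * f ^+ (k - j.+1) = 0]].

End Ideals.

(* The germ [(X, 0)] is given by its normalization map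
   [eta = (eta_1, .., eta_k) : (K^n, 0) -> (X, 0)], [(X, 0)] a germ in
   [(K^k, 0)]; thus the integral closure of its local ring in its fraction
   field is [K{x_1, .., x_n}], and the kernel of the map onto the local ring of
   the fibre product of [eta] with itself is spanned by the
   [eta_i(x) - eta_i(y)]. *)

Section Lipschitz.
Variables (n k : nat) (K : numFieldType).
Implicit Types eta : k.-tuple (cvps n K).

Definition diagonal_ideal eta : set (cvps (n + n) K) :=
  ideal_span [set g | exists i : 'I_k,
    g = in_x (tnth eta i) - in_y (tnth eta i)].

Definition lipschitz_saturation eta : set (cvps n K) := [set f |
  ideal_integral_closure (diagonal_ideal eta) (in_x f - in_y f)].

End Lipschitz.

Definition toric_normalization (K : numFieldType) (alpha beta N : nat) :
    3.-tuple (cvps 2 K) :=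
  let u := cvpsX ord0 in let v := cvpsX ord_max in
  [tuple u; u ^+ alpha * v ^+ beta; v ^+ N].

Definition numerical_semigroup (S : set nat) : Prop :=
  [/\ S 0%N, forall s t, S s -> S t -> S (s + t)%N &
      exists c : nat, forall s, (c <= s)%N -> S s].

Definition semigroup_gen2 (p q : nat) : set nat :=
  [set s | exists i j : nat, s = (i * p + j * q)%N].

Definition saturated (S : set nat) : Prop :=
  forall (s r : nat) (t : 'I_r -> nat) (z : 'I_r -> int),
    S s -> (forall i, S (t i) /\ (t i <= s)%N) ->
    0 <= \sum_(i < r) z i * (t i)%:Z ->
    S (s + `|(\sum_(i < r) z i * (t i)%:Z)%R|)%N.

Definition semigroup_saturation (T : set nat) : set nat :=
  \bigcap_(S in [set S | [/\ numerical_semigroup S, saturated S & T `<=` S]]) S.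

(* The intersection above is the smallest saturated numerical semigroup
   containing [T]. *)
Lemma semigroup_saturationP (T : set nat) : numerical_semigroup T ->
  [/\ numerical_semigroup (semigroup_saturation T),
      saturated (semigroup_saturation T),
      T `<=` semigroup_saturation T &
      forall S, numerical_semigroup S -> saturated S -> T `<=` S ->
        semigroup_saturation T `<=` S].
Proof.
move=> [T0 TD [c Tc]].
have sub : T `<=` semigroup_saturation T.
  by move=> t Tt S [_ _]; apply.
split=> //; last by move=> S S1 S2 TS s; apply.
- split; [exact: sub| |by exists c => s cs; exact: sub (Tc s cs)].
  by move=> s t Ss St S SP; have [[_ D _] _ _] := SP; apply: D; [exact: Ss|exact: St].
- move=> s r t z Ss St z0 S SP; have [_ sat _] := SP; apply: sat => //.
    exact: Ss.
  by move=> i; have [Si ->] := St i; split=> //; exact: Si.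
Qed.

(* Main.v *)
Require Import Defs.
From mathcomp Require Import all_boot all_order all_algebra.
From mathcomp Require Import boolp classical_sets reals.
From mathcomp Require Import complex.
From mathcomp Require Import perm cyclic separable cyclotomic mpoly.
From mathcomp Require Import zify ring.

Set Implicit Arguments.
Unset Strict Implicit.
Unset Printing Implicit Defensive.

Import Order.TTheory GRing.Theory Num.Theory.
Local Open Scope ring_scope.

(** Write x1, x2, y1, y2 for the coordinates on the double of the normalization
    and D n for x2^n - y2^n.  Modulo x1 - y1, the diagonal ideal I is generated
    by x1^alpha D beta and D N, and the difference of the two copies of
    u^a v^b becomes x1^a D b.

    Sufficiency.  If N divides b, or beta divides b and alpha <= a, then
    x1^a D b is a multiple of a generator.  The remaining case is alpha <= a and
    b >= max N beta.  Subtracting, as in Euclid's algorithm, D p from D q shows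
    that every form of high degree in x2, y2 times x2 - y2 is a combination of
    D N and D beta with coefficients that are forms of the expected degree
    ([euclid_forms]); this is where gcd N beta = 1 enters.  Hence, for k large,
    multiplication by D b sends the module M of multiples of forms of degree k
    into M D N + M D beta, because b is at least N and beta, and x1^a D b sends
    M into I M.  As M is finitely generated and contains the regular element
    x2^k, Cayley-Hamilton makes x1^a D b, and any translate of it by an element
    of I, integral over I ([determinant_trick], [integral_difference]).

    Necessity.  An element integral over I has, along every arc, order at least
    the order of I ([arc_criterion]).  Along the arcs
    x1 = y1 = t^q, x2 = t^p, y2 = z t^p with z a root of unity, x1^a D b has
    order q a + p b as soon as z^b <> 1.  If N does not divide b, a primitive
    N-th root of unity kills D N, leaving q alpha + p beta <= q a + p b for all
    p and q, that is alpha <= a and beta <= b.  If beta does not divide b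
    either, a primitive beta-th root of unity kills D beta, leaving
    p N <= q a + p b, whence N <= b.

    These conditions on b describe the saturation of the semigroup generated by
    N and beta: the multiples of the smaller generator and everything from the
    larger one on ([saturation_gen2]). *)

(** * Ideals and integral closure *)

Section Ideals.
Variable A : comNzRingType.
Implicit Types (S I : set A) (f g : A).

Lemma ideal_span_sub S f : S f -> ideal_span S f.
Proof.
by move=> Sf; exists 1%N, (fun=> 1), (fun=> f); rewrite big_ord1 mul1r.
Qed.

Lemma ideal_span0 S : ideal_span S 0.
Proof.
by exists 0%N, (fun=> 0), (fun=> 0); split; [case | rewrite big_ord0].
Qed.

Lemma ideal_spanD S f g : ideal_span S f -> ideal_span S g ->
  ideal_span S (f + g).
Proof.
move=> [k [c [s [Ss ->]]]] [l [c' [s' [Ss' ->]]]].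
pose glue (u : 'I_k -> A) (u' : 'I_l -> A) (i : 'I_(k + l)) :=
  match split i with inl j => u j | inr j => u' j end.
exists (k + l)%N, (glue c c'), (glue s s'); split.
  by move=> i; rewrite /glue; case: (split i) => j.
rewrite big_split_ord; congr (_ + _); apply: eq_bigr => i _.
  by rewrite /glue (unsplitK (inl i)).
by rewrite /glue (unsplitK (inr i)).
Qed.

Lemma ideal_spanM S f g : ideal_span S g -> ideal_span S (f * g).
Proof.
move=> [k [c [s [Ss ->]]]]; exists k, (fun i => f * c i), s; split=> //.
by rewrite mulr_sumr; apply: eq_bigr => i _; rewrite mulrA.
Qed.

Lemma ideal_spanMr S f g : ideal_span S f -> ideal_span S (f * g).
Proof. by rewrite mulrC; apply: ideal_spanM. Qed.

Lemma ideal_spanN S f : ideal_span S f -> ideal_span S (- f).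
Proof. by rewrite -mulN1r; apply: ideal_spanM. Qed.

Lemma ideal_span_sum S (T : Type) (r : seq T) (P : pred T) (F : T -> A) :
  (forall i, P i -> ideal_span S (F i)) ->
  ideal_span S (\sum_(i <- r | P i) F i).
Proof.
by move=> SF; apply: (big_ind (ideal_span S)) => //;
  [exact: ideal_span0 | move=> f g; exact: ideal_spanD].
Qed.

(** Minimality of the span, stated for a bare predicate so that it serves as an
    induction principle. *)
Lemma ideal_span_ind S (P : A -> Prop) :
  P 0 -> (forall f g, P f -> P g -> P (f + g)) ->
  (forall f g, P g -> P (f * g)) -> (forall f, S f -> P f) ->
  forall f, ideal_span S f -> P f.
Proof.
move=> P0 PD PM PS f [k [c [s [Ss ->]]]].
by apply: (big_ind P) => // i _; apply/PM/PS.
Qed.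

Lemma ideal_power0 I f : ideal_power I 0 f.
Proof.
rewrite -[f]mulr1; apply/ideal_spanM/ideal_span_sub.
by exists (fun=> 0); rewrite big_ord0; split=> // -[].
Qed.

Lemma ideal_power1 I f : I f -> ideal_power I 1 f.
Proof.
move=> If; apply: ideal_span_sub.
by exists (fun=> f); rewrite big_ord1.
Qed.

Lemma ideal_powerM I i j f g : ideal_power I i f -> ideal_power I j g ->
  ideal_power I (i + j) (f * g).
Proof.
move=> If Ig; elim/ideal_span_ind: If => [|f1 f2 H1 H2|c f1 H1|f1 [s [Is ->]]].
- by rewrite mul0r; exact: ideal_span0.
- by rewrite mulrDl; exact: ideal_spanD.
- by rewrite -mulrA; exact: ideal_spanM.
elim/ideal_span_ind: Ig => [|g1 g2 H1 H2|c g1 H1|g1 [s' [Is' ->]]].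
- by rewrite mulr0; exact: ideal_span0.
- by rewrite mulrDr; exact: ideal_spanD.
- by rewrite mulrCA; exact: ideal_spanM.
apply: ideal_span_sub.
exists (fun l => match split l with inl j => s j | inr j => s' j end); split.
  by move=> l; case: (split l).
rewrite big_split_ord; congr (_ * _); apply: eq_bigr => l _.
  by rewrite (unsplitK (inl l)).
by rewrite (unsplitK (inr l)).
Qed.

Lemma integral_closure_ideal I f : I (- f) -> ideal_integral_closure I f.
Proof.
move=> If; exists 1%N, (fun=> - f); split=> //.
  by move=> j; rewrite (ord1 j); exact: ideal_power1.
by rewrite big_ord1 subnn expr0 mulr1 expr1 subrr.
Qed.

(** For size p <= r + 1: giving the variable weight 1 and I ^ j weight j, each
    term of p has weight at least r.  For a monic p of degree r these are the
    equations that define integrality over I. *)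
Definition graded_le I (r : nat) (p : {poly A}) : Prop :=
  forall i, (i <= r)%N -> ideal_power I (r - i) p`_i.

Lemma graded_leM I r s (p q : {poly A}) :
  (size p <= r.+1)%N -> (size q <= s.+1)%N ->
  graded_le I r p -> graded_le I s q -> graded_le I (r + s) (p * q).
Proof.
move=> sp sq Ip Iq i irs; rewrite coefM; apply: ideal_span_sum => -[j ji] _ /=.
have [jr|rj] := leqP j r; last first.
  by rewrite nth_default ?mul0r ?(leq_trans sp) //; exact: ideal_span0.
have [ijs|sij] := leqP (i - j) s; last first.
  by rewrite [q`_ _]nth_default ?mulr0 ?(leq_trans sq) //; exact: ideal_span0.
have -> : (r + s - i = (r - j) + (s - (i - j)))%N by lia.
by apply: ideal_powerM; [exact: Ip | exact: Iq].
Qed.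

(** In the Leibniz formula each of the r factors has weight 1: an entry of
    'X - C is 'X up to an element of I, or just an element of I. *)
Lemma char_poly_graded I r (C : 'M[A]_r) : (forall f, I f -> I (- f)) -> I 0 ->
  (forall i j, I (C i j)) -> graded_le I r (char_poly C).
Proof.
move=> IN I0 IC i ir; rewrite /char_poly /determinant coef_sum.
apply: ideal_span_sum => /= s _.
suff: forall m (e : seq 'I_r), size e = m ->
    (size (\prod_(j <- e) char_poly_mx C j (s j))%R <= m.+1)%N /\
    graded_le I m (\prod_(j <- e) char_poly_mx C j (s j)).
  move=> /(_ r (index_enum 'I_r)) [|_ H].
    by rewrite -[RHS](card_ord r) cardE enumT.
  by have := H i ir; rewrite -(rmorph_sign polyC) coefCM; exact: ideal_spanM.
move=> m e; elim: e m => [|j e IHe] [|m] //.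
  move=> _; rewrite big_nil size_poly1; split=> // l.
  by rewrite leqn0 => /eqP ->; exact: ideal_power0.
move=> [] /IHe [se Ie]; rewrite big_cons.
have sj : (size (char_poly_mx C j (s j)) <= 2)%N.
  rewrite !mxE; case: (_ == _); rewrite ?mulr1n ?mulr0n ?sub0r.
    by rewrite size_XsubC.
  by rewrite size_polyN (leq_trans (size_polyC_leq1 _)).
split.
  apply: (leq_trans (size_polyMleq _ _)); move: sj se.
  by lia.
rewrite -add1n; apply: graded_leM => // -[|[|l]] //= _; last first.
  exact: ideal_power0.
rewrite !mxE; apply: ideal_power1.
by case: (_ == _);
  rewrite ?mulr1n ?mulr0n coefB ?coefX ?coef0 coefC /= sub0r; exact: IN.
Qed.

(** The adjugate of g - C annihilates the column v up to its determinant, the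
    value at g of the characteristic polynomial of C; a regular v i0 turns this
    into a polynomial equation for g, which is one of integral dependence by
    [char_poly_graded]. *)
Lemma determinant_trick S r (C : 'M[A]_r) (v : 'I_r -> A) (g : A) (i0 : 'I_r) :
  (forall i j, ideal_span S (C i j)) ->
  (forall i, g * v i = \sum_j C i j * v j) -> GRing.lreg (v i0) ->
  ideal_integral_closure (ideal_span S) g.
Proof.
move=> IC gv reg; set p := char_poly C.
have grd : graded_le (ideal_span S) r p.
  by apply: char_poly_graded => //; [exact: ideal_spanN | exact: ideal_span0].
have detE : \det (g%:M - C) = p.[g].
  rewrite -[RHS]/(horner_eval g p) /p /char_poly -det_map_mx; congr (\det _).
  apply/matrixP => i j; rewrite !mxE.
  by rewrite /= /horner_eval hornerD hornerN hornerMn hornerX hornerC.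
have pg0 : p.[g] = 0.
  pose w := \col_i v i.
  have wC : (g%:M - C) *m w = 0.
    apply/matrixP => i j; rewrite mulmxBl mul_scalar_mx !mxE gv.
    apply/eqP; rewrite subr_eq0; apply/eqP.
    by apply: eq_bigr => l _; rewrite mxE.
  have : \adj (g%:M - C) *m ((g%:M - C) *m w) = 0 by rewrite wC mulmx0.
  rewrite mulmxA mul_adj_mx detE mul_scalar_mx => /matrixP /(_ i0 0).
  by rewrite !mxE mulrC -[RHS](mulr0 (v i0)) => /reg.
have sp : size p = r.+1 by exact: size_char_poly.
exists r, (fun j => p`_(r - j.+1)); split.
- by case: r i0 {C v p IC gv reg grd detE pg0 sp} => [[]|].
- move=> j; have := grd (r - j.+1)%N (leq_subr _ _).
  by rewrite subKn.
have := char_poly_monic C; rewrite monicE lead_coefE -/p sp /= => /eqP pr.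
move: pg0; rewrite horner_coef sp big_ord_recr /= pr mul1r addrC.
by rewrite (reindex_inj rev_ord_inj) /=.
Qed.

End Ideals.

(** * Differences of powers of two elements *)

Section Forms.
Variables (A : comNzRingType) (X Y : A).
Implicit Types (P Q : A) (k p q : nat).

(** The ideal (X, Y) ^ k, given by the monomials that will index the matrix of
    the determinant trick. *)
Definition forms k : set A :=
  ideal_span (fun f => exists i j, (i + j)%N = k /\ f = X ^+ i * Y ^+ j).

Lemma monomial_forms i j k : (k <= i + j)%N -> forms k (X ^+ i * Y ^+ j).
Proof.
move=> kij; have -> : X ^+ i * Y ^+ j =
    (X ^+ (i - k) * Y ^+ (i + j - maxn i k)) * (X ^+ minn i k * Y ^+ (k - i)).
  rewrite mulrACA -!exprD; congr (X ^+ _ * Y ^+ _); lia.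
apply/ideal_spanM/ideal_span_sub; exists (minn i k), (k - i)%N; split=> //; lia.
Qed.

Lemma formsM i j k l P : (l <= i + j + k)%N -> forms k P ->
  forms l (X ^+ i * Y ^+ j * P).
Proof.
move=> lijk; elim/ideal_span_ind => [|f g Hf Hg|c f Hf|f [i' [j' [ij' ->]]]].
- by rewrite mulr0; exact: ideal_span0.
- by rewrite mulrDr; exact: ideal_spanD.
- by rewrite mulrCA; exact: ideal_spanM.
by rewrite mulrACA -!exprD; apply: monomial_forms; lia.
Qed.

Lemma formsW k l P : (l <= k)%N -> forms k P -> forms l P.
Proof.
by move=> lk Pk; rewrite -[P]mul1r -[1]mulr1; exact: (@formsM 0 0 k).
Qed.

Lemma forms_coef k P : forms k P ->
  exists c : 'I_k.+1 -> A, P = \sum_i c i * (X ^+ i * Y ^+ (k - i)).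
Proof.
elim/ideal_span_ind => [|f g [c ->] [c' ->]|f g [c ->]|f [i [j [<- ->]]]].
- by exists (fun=> 0); rewrite big1 // => i _; rewrite mul0r.
- exists (fun l => c l + c' l); rewrite -big_split /=.
  by apply: eq_bigr => i _; rewrite mulrDl.
- exists (fun l => f * c l); rewrite mulr_sumr.
  by apply: eq_bigr => i _; rewrite mulrA.
have ik : (i < (i + j).+1)%N by rewrite ltnS leq_addr.
exists (fun l => (l == Ordinal ik)%:R).
rewrite (bigD1 (Ordinal ik)) //= eqxx mul1r big1 ?addr0.
  by rewrite addKn.
by move=> l /negPf ->; rewrite mul0r.
Qed.

Local Notation D n := (X ^+ n - Y ^+ n).

(** Euclid's algorithm on exponents: X^q D(p - q) = D p - Y^(p - q) D q and
    symmetrically for Y^q, while a monomial of degree at least 2q - 1 is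
    divisible by X^q or Y^q.  The degrees of P and Q are those that homogeneity
    dictates. *)
Lemma euclid_forms p q : exists K, forall i j, (K <= i + j)%N ->
  exists P Q, [/\ forms (i + j + gcdn p q - p) P,
    forms (i + j + gcdn p q - q) Q &
    X ^+ i * Y ^+ j * D (gcdn p q) = P * D p + Q * D q].
Proof.
have [n] := ubnP (p + q); elim: n p q => // n IHn p q; rewrite ltnS => pqn.
wlog qp : p q pqn / (q <= p)%N => [H|].
  have [qp|/ltnW pq] := leqP q p; first exact: H.
  rewrite addnC in pqn; have [K HK] := H q p pqn pq.
  rewrite gcdnC; exists K => i j /HK[P [Q [HP HQ E]]].
  by exists Q, P; split=> //; rewrite E addrC.
case: (posnP q) => [->|q0].
  exists 0%N => i j _; exists (X ^+ i * Y ^+ j), 0; rewrite gcdn0; split.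
  - by apply: monomial_forms; lia.
  - exact: ideal_span0.
  - by rewrite mul0r addr0.
have [|K HK] := IHn (p - q)%N q; first lia.
have gE : gcdn (p - q) q = gcdn p q.
  by rewrite [RHS]gcdnC -[in RHS](subnK qp) gcdnDr gcdnC.
have Dp : D p = X ^+ (p - q) * X ^+ q - Y ^+ (p - q) * Y ^+ q.
  by rewrite -!exprD subnK.
rewrite gE in HK; exists (K + q + q)%N => i j Kij.
set g := gcdn p q in HK *.
have [qi|iq] := leqP q i.
  have [|P [Q [HP HQ E]]] := HK (i - q)%N j; first lia.
  exists P, (X ^+ q * Y ^+ 0 * Q - X ^+ 0 * Y ^+ (p - q) * P); split.
  - by apply: formsW HP; lia.
  - by apply: ideal_spanD; [|apply: ideal_spanN];
      [apply: formsM HQ | apply: formsM HP]; lia.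
  - rewrite -{1}(subnK qi).
    transitivity (X ^+ q * (X ^+ (i - q) * Y ^+ j * D g)).
      by rewrite exprD; ring.
    by rewrite E Dp; ring.
have [|P [Q [HP HQ E]]] := HK i (j - q)%N; first lia.
exists P, (X ^+ 0 * Y ^+ q * Q - X ^+ (p - q) * Y ^+ 0 * P); split.
- by apply: formsW HP; lia.
- by apply: ideal_spanD; [|apply: ideal_spanN];
    [apply: formsM HQ | apply: formsM HP]; lia.
have qj : (q <= j)%N by lia.
rewrite -{1}(subnK qj).
transitivity (Y ^+ q * (X ^+ i * Y ^+ (j - q) * D g)).
  by rewrite exprD; ring.
by rewrite E Dp; ring.
Qed.

(** Since b is at least p and q, the degrees in [euclid_forms] show that W * D b
    maps forms of degree K into the ideal times forms of degree K; adding h only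
    changes the diagonal of the matrix.  The coprimality gives gcd 1, and D 1
    divides D b. *)
Lemma integral_difference p q b (W h : A) (S : set A) :
  coprime p q -> (0 < b)%N -> (p <= b)%N -> (q <= b)%N -> GRing.lreg X ->
  ideal_span S (W * D p) -> ideal_span S (W * D q) -> ideal_span S h ->
  ideal_integral_closure (ideal_span S) (W * D b + h).
Proof.
move=> /eqP pq1 b0 pb qb regX Ip Iq Ih.
have [K HK] := euclid_forms p q; rewrite pq1 in HK.
have stable i j : (i + j)%N = K -> exists P Q, [/\ forms K P, forms K Q &
    D b * (X ^+ i * Y ^+ j) = P * D p + Q * D q].
  move=> ijK; rewrite subrXX mulrAC mulr_sumr.
  apply: (big_ind (fun f => exists P Q, [/\ forms K P, forms K Q &
    f = P * D p + Q * D q])).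
  - exists 0, 0; split; try exact: ideal_span0.
    by rewrite !mul0r addr0.
  - move=> f1 f2 [P1 [Q1 [HP1 HQ1 ->]]] [P2 [Q2 [HP2 HQ2 ->]]].
    exists (P1 + P2), (Q1 + Q2); split; try exact: ideal_spanD.
    by ring.
  move=> [l lb] _ /=.
  have [|P [Q [HP HQ E]]] := HK (i + (b.-1 - l))%N (j + l)%N; first lia.
  exists P, Q; split; [by apply: formsW HP; lia|by apply: formsW HQ; lia|].
  rewrite -E !exprD !expr1; ring.
pose v (i : 'I_K.+1) := X ^+ i * Y ^+ (K - i).
have row i : exists c : 'I_K.+1 -> A, (forall j, ideal_span S (c j)) /\
    (W * D b) * v i = \sum_j c j * v j.
  have [|P [Q [/forms_coef[c ->] /forms_coef[c' ->] E]]] := stable i (K - i)%N.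
    by rewrite subnKC // -ltnS.
  exists (fun l => c l * (W * D p) + c' l * (W * D q)); split.
    by move=> j; apply: ideal_spanD; exact: ideal_spanM.
  rewrite -mulrA E !mulr_suml mulrDr !mulr_sumr -big_split /=.
  by apply: eq_bigr => j _; rewrite /v; ring.
have [C HC] := choice row.
apply: (@determinant_trick _ S _
  (\matrix_(i, j) (C i j + h *+ (i == j))) v _ ord_max).
- move=> i j; rewrite !mxE; apply: ideal_spanD; first by have [] := HC i.
  by case: (_ == _); rewrite ?mulr1n ?mulr0n //; exact: ideal_span0.
- move=> i; have [_ E] := HC i; rewrite mulrDl E.
  under [RHS]eq_bigr => j _ do rewrite !mxE mulrDl.
  rewrite big_split /=; congr (_ + _).
  rewrite (bigD1 i) //= eqxx mulr1n big1 ?addr0 // => j ji.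
  by rewrite eq_sym (negPf ji) mulr0n mul0r.
by rewrite /v /= subnn expr0 mulr1; exact: GRing.lregX.
Qed.

End Forms.

(** * The saturated numerical semigroup *)

(** Below maxn p q all elements are multiples of minn p q, and so are their
    integral combinations; from maxn p q on there is nothing to check. *)
Lemma saturated_min_max (p q : nat) : (0 < p)%N -> (0 < q)%N ->
  let S := fun b => (minn p q %| b)%N || (maxn p q <= b)%N in
  [/\ numerical_semigroup S, saturated S &
      forall b, semigroup_gen2 p q b -> S b].
Proof.
move=> p0 q0 S; split.
- split=> [|s t|].
  + by rewrite /S dvdn0.
  + rewrite /S => /orP[ds|ms] /orP[dt|mt].
    * by rewrite dvdn_add.
    * by rewrite (leq_trans mt (leq_addl _ _)) orbT.
    * by rewrite (leq_trans ms (leq_addr _ _)) orbT.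
    * by rewrite (leq_trans ms (leq_addr _ _)) orbT.
  + by exists (maxn p q) => s ms; rewrite /S ms orbT.
- move=> s r t z Ss St z0; rewrite /S.
  have [ms|sm] := leqP (maxn p q) s.
    by rewrite (leq_trans ms (leq_addr _ _)) orbT.
  have dvd_below c : S c -> (c <= s)%N -> (minn p q %| c)%N.
    by move=> /orP[//|mc] cs; move: sm; rewrite ltnNge (leq_trans mc cs).
  apply/orP; left; apply: dvdn_add; first exact: dvd_below.
  change ((minn p q)%:Z %| \sum_(i < r) z i * (t i)%:Z)%Z.
  apply: rpred_sum => i _; apply: dvdz_mull.
  by have [Si ti] := St i; exact: dvd_below.
- move=> _ [i [j ->]]; rewrite /S; have [pq|qp] := leqP p q.
    case: j => [|j]; first by rewrite mul0n addn0 dvdn_mull.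
    by rewrite mulSn addnCA leq_addr orbT.
  case: i => [|i]; first by rewrite mul0n add0n dvdn_mull.
  by rewrite mulSn -addnA leq_addr orbT.
Qed.

(** The lower bound: with s = maxn p q, the Bezout relation writes any d >= 0 as
    an integral combination of p and q, so saturation forces s + d into S. *)
Lemma saturation_gen2 (p q b : nat) : (0 < p)%N -> (0 < q)%N -> coprime p q ->
  semigroup_saturation (semigroup_gen2 p q) b <->
  (minn p q %| b)%N || (maxn p q <= b)%N.
Proof.
move=> p0 q0 pq; split=> [Tb|].
  have [S1 S2 S3] := saturated_min_max p0 q0.
  exact: (Tb _ (And3 S1 S2 S3)).
move=> Sb S [_ satS TS].
have Sp : S p by apply: TS; exists 1%N, 0%N; rewrite mul1n mul0n addn0.
have Sq : S q by apply: TS; exists 0%N, 1%N; rewrite mul1n mul0n add0n.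
case/orP: Sb => [/dvdnP[k ->]|mb].
  apply: TS; case: (leqP p q) => _; [exists k, 0%N | exists 0%N, k];
    by rewrite mul0n ?addn0 ?add0n.
have [[u v] /= uv1] := coprimezP p q pq.
pose t (i : 'I_2) := if i == ord0 then p else q.
pose d := (b - maxn p q)%N.
pose z (i : 'I_2) := d%:Z * (if i == ord0 then u else v).
have zt : \sum_(i < 2) z i * (t i)%:Z = d%:Z.
  rewrite big_ord_recl big_ord1 /z /t /= -!mulrA -mulrDr.
  by rewrite -[RHS]mulr1 -uv1.
have := satS (maxn p q) 2%N t z; rewrite zt absz_nat subnKC //; apply=> //.
  by case: (leqP p q).
by move=> i; rewrite /t; case: (i == ord0); split=> //; lia.
Qed.

(** * Monomials in convergent power series *)

Section Monomials.
Variables (n : nat) (K : numFieldType).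
Implicit Types (m : 'X_{1..n}).

Definition cvps_monom m : cvps n K := Cvps (convergent_monom K m).

Lemma fps_trunc_monom d m : (mdeg m < d)%N ->
  fps_trunc d (fps_monom K m) = 'X_[m].
Proof.
move=> md; apply/mpolyP => k; rewrite mcoeffX.
have [kd|dk] := ltnP (mdeg k) d; first by rewrite mcoeff_trunc //= eq_sym.
rewrite /fps_trunc raddf_sum /= big1.
  by case: eqP => // mk; move: md; rewrite mk ltnNge dk.
move=> l _; rewrite mcoeffZ mcoeffX.
have [lk|_] := eqVneq (l : 'X_{1..n}) k; last by rewrite mulr0.
by move: (bmdeg l); rewrite lk ltnNge dk.
Qed.

Lemma fcoefM_trunc d (f g : fps n K) m : (mdeg m < d)%N ->
  fcoef (f * g) m = (fps_trunc d f * fps_trunc d g)@_m.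
Proof. exact: fps_mulE. Qed.

Lemma fcoef_monomM m k (f : fps n K) :
  fcoef (fps_monom K m * f) (m + k)%MM = fcoef f k.
Proof.
pose d := (mdeg (m + k)).+1.
have md : (mdeg m < d)%N by rewrite /d mdegD ltnS leq_addr.
have kd : (mdeg k < d)%N by rewrite /d mdegD ltnS leq_addl.
rewrite (fcoefM_trunc (d := d)) // fps_trunc_monom // mulrC mcoeffMX.
exact: mcoeff_trunc.
Qed.

Lemma cvps_monomD m1 m2 :
  cvps_monom (m1 + m2)%MM = cvps_monom m1 * cvps_monom m2.
Proof.
apply/val_inj/fpsP => m; pose d := (mdeg m + (mdeg m1 + mdeg m2)).+1.
rewrite -[RHS]/(fcoef (fps_monom K m1 * fps_monom K m2) m).
rewrite (fcoefM_trunc (d := d)) ?ltnS ?leq_addr //.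
rewrite !fps_trunc_monom; last 2 first.
- by rewrite /d; lia.
- by rewrite /d; lia.
by rewrite -mpolyXD mcoeffX /= eq_sym.
Qed.

Lemma cvps_monom0 : cvps_monom 0%MM = 1.
Proof. exact: val_inj. Qed.

Lemma cvps_monomMn m k : cvps_monom (m *+ k)%MM = cvps_monom m ^+ k.
Proof.
elim: k => [|k IHk]; first by rewrite mulm0n cvps_monom0.
by rewrite mulmS exprS cvps_monomD IHk.
Qed.

Lemma cvps_monom_prod (I : finType) (F : I -> 'I_n) (e : I -> nat) :
  cvps_monom (\sum_i U_(F i) *+ e i)%MM = \prod_i cvpsX (F i) ^+ e i.
Proof.
rewrite (big_morph cvps_monom cvps_monomD cvps_monom0).
by apply: eq_bigr => i _; rewrite cvps_monomMn.
Qed.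

Lemma cvpsX_lreg (i : 'I_n) : GRing.lreg (cvpsX i : cvps n K).
Proof.
move=> f g /(congr1 val) fg; apply/val_inj/fpsP => m.
by rewrite -(fcoef_monomM U_(i)%MM) -[RHS](fcoef_monomM U_(i)%MM); congr fcoef.
Qed.

End Monomials.

Lemma cvps_rename_monomial n p (K : numFieldType) (sigma : 'I_n -> 'I_p)
    (inj : injective sigma) (e : 'I_n -> nat) :
  cvps_rename inj (\prod_i cvpsX i ^+ e i) = \prod_i cvpsX (sigma i) ^+ e i
  :> cvps p K.
Proof.
rewrite -!cvps_monom_prod; apply/val_inj/fpsP => m /=.
set m1 := (\sum_i U_(i) *+ e i)%MM; set m2 := (\sum_i U_(sigma i) *+ e i)%MM.
have sup : mnm_supported sigma m2.
  apply/forallP => j; apply/implyP; apply: contraR => jn.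
  rewrite mnm_sumE big1 // => i _; rewrite mulmnE mnm1E.
  by case: eqP => // ij; case/negP: jn; rewrite -ij codom_f.
have res : mnm_restrict sigma m2 = m1.
  apply/mnmP => i; rewrite mnmE !mnm_sumE; apply: eq_bigr => j _.
  by rewrite !mulmnE !mnm1E (inj_eq inj).
case: ifP => sm; last by case: eqP => // mm2; rewrite mm2 sup in sm.
congr (nat_of_bool _)%:R; apply/eqP/eqP => [E|->]; last exact: res.
by apply: (mnm_restrict_inj sm sup); rewrite E res.
Qed.

(** * Orders along arcs *)

Section Arcs.
Variables (n : nat) (K : numFieldType) (c : 'I_n -> K) (w : 'I_n -> nat).
Hypothesis w_gt0 : forall i, (0 < w i)%N.
Implicit Types (f g : cvps n K) (p q : {poly K}).

(** Substitution of the arc x_i = c_i t^(w_i).  As w_i > 0, the terms of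
    degree at least d only contribute multiples of t^d, so the truncated
    substitution is right modulo t^d and stays within polynomials. *)
Definition arc_eval d f : {poly K} :=
  mmap polyC (fun i => c i *: 'X^(w i)) (fps_trunc d (val f)).

(** p represents the restriction of f to the arc modulo t^d. *)
Definition arc_jet d f p : Prop := 'X^d %| arc_eval d f - p.

Lemma arc_mmap1 (m : 'X_{1..n}) :
  mmap1 (fun i => c i *: 'X^(w i)) m =
  (\prod_i c i ^+ m i) *: 'X^(\sum_i w i * m i).
Proof.
rewrite -prodrXr -scaler_prod; apply: eq_bigr => i _.
by rewrite exprZn -exprM.
Qed.

Lemma arc_mmap1_dvd d (m : 'X_{1..n}) : (d <= mdeg m)%N ->
  'X^d %| mmap1 (fun i => c i *: 'X^(w i)) m.
Proof.
move=> dm; rewrite arc_mmap1 -mul_polyC dvdp_mull // dvdp_Pexp2l ?size_polyX //.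
rewrite (leq_trans dm) // mdegE leq_sum // => i _.
by rewrite -[leqLHS]mul1n leq_mul2r w_gt0 orbT.
Qed.

Lemma arc_mmap_dvd d (P : {mpoly K[n]}) :
  (forall m, (mdeg m < d)%N -> P@_m = 0) ->
  'X^d %| mmap polyC (fun i => c i *: 'X^(w i)) P.
Proof.
move=> P0; rewrite /mmap; apply: (big_ind (fun q => 'X^d %| q)) => //.
  by move=> p q; exact: dvdp_add.
move=> m _; have [md|dm] := ltnP (mdeg m) d; last first.
  by rewrite dvdp_mull ?arc_mmap1_dvd.
by rewrite P0 // polyC0 mul0r dvdp0.
Qed.

Lemma fps_truncD d (f g : fps n K) :
  fps_trunc d (f + g) = fps_trunc d f + fps_trunc d g.
Proof.
by rewrite /fps_trunc -big_split /=; apply: eq_bigr => m _; rewrite -scalerDl.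
Qed.

Lemma arc_evalD d f g : arc_eval d (f + g) = arc_eval d f + arc_eval d g.
Proof. by rewrite /arc_eval raddfD /= fps_truncD raddfD. Qed.

Lemma arc_jetD d f g p q :
  arc_jet d f p -> arc_jet d g q -> arc_jet d (f + g) (p + q).
Proof.
rewrite /arc_jet arc_evalD => fp gq.
by rewrite opprD addrACA dvdp_add.
Qed.

(** Truncation is multiplicative up to terms of degree at least d, which the
    substitution sends to multiples of t^d. *)
Lemma arc_jetM d f g p q :
  arc_jet d f p -> arc_jet d g q -> arc_jet d (f * g) (p * q).
Proof.
rewrite /arc_jet => fp gq; set F := arc_eval d f; set G := arc_eval d g.
have -> : arc_eval d (f * g) - p * q =
    (arc_eval d (f * g) - F * G) + (F - p) * G + p * (G - q) by ring.
apply: dvdp_add (dvdp_mull _ gq); apply: dvdp_add (dvdp_mulr _ fp).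
have -> : F * G = mmap polyC (fun i => c i *: 'X^(w i))
    (fps_trunc d (val f) * fps_trunc d (val g)) by rewrite rmorphM.
rewrite /arc_eval -raddfB /=; apply: arc_mmap_dvd => m md.
rewrite mcoeffB mcoeff_trunc // (fcoefM_trunc _ _ md) subrr //.
Qed.

Lemma arc_jet_monom d m :
  arc_jet d (cvps_monom K m) ((\prod_i c i ^+ m i) *: 'X^(\sum_i w i * m i)).
Proof.
rewrite /arc_jet /arc_eval -arc_mmap1 -(mmapX _ polyC) -raddfB /=.
apply: arc_mmap_dvd => k kd; rewrite mcoeffB mcoeff_trunc //= mcoeffX eq_sym.
by rewrite subrr.
Qed.

Lemma arc_jet0 d : arc_jet d 0 0.
Proof.
rewrite /arc_jet subr0 /arc_eval /fps_trunc big1 ?mmap0 ?dvdp0 // => m _.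
by rewrite scale0r.
Qed.

Lemma arc_jet1 d : arc_jet d 1 1.
Proof.
have := arc_jet_monom d 0%MM; rewrite cvps_monom0.
have -> : \prod_i c i ^+ (0 : 'X_{1..n})%MM i = 1.
  by apply: big1 => i _; rewrite mnm0E.
have -> : (\sum_i w i * (0 : 'X_{1..n})%MM i)%N = 0%N.
  by apply: big1 => i _; rewrite mnm0E muln0.
by rewrite expr0 scale1r.
Qed.

Lemma arc_jetX d i : arc_jet d (cvpsX i) (c i *: 'X^(w i)).
Proof.
have := arc_jet_monom d U_(i)%MM; congr (arc_jet _ _ (_ *: 'X^ _)).
  rewrite (bigD1 i) //= mnm1E eqxx expr1 big1 ?mulr1 // => j ji.
  by rewrite mnm1E eq_sym (negPf ji).
rewrite (bigD1 i) //= mnm1E eqxx muln1 big1 ?addn0 // => j ji.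
by rewrite mnm1E eq_sym (negPf ji) muln0.
Qed.

Lemma arc_jetXn d f p k : arc_jet d f p -> arc_jet d (f ^+ k) (p ^+ k).
Proof.
move=> fp; elim: k => [|k IHk]; first exact: arc_jet1.
by rewrite !exprS; exact: arc_jetM.
Qed.

Lemma arc_jetN d f p : arc_jet d f p -> arc_jet d (- f) (- p).
Proof.
rewrite /arc_jet; have -> : arc_eval d (- f) = - arc_eval d f.
  rewrite /arc_eval raddfN -[RHS]raddfN /=; congr (mmap _ _ _).
  by rewrite /fps_trunc -sumrN /=; apply: eq_bigr => m _; rewrite -scaleNr.
by rewrite -opprD dvdpNr.
Qed.

Lemma arc_jet_self d f : arc_jet d f (arc_eval d f).
Proof. by rewrite /arc_jet subrr dvdp0. Qed.

Lemma arc_jet_uniq d f p q : arc_jet d f p -> arc_jet d f q -> 'X^d %| p - q.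
Proof.
move=> fp fq; have -> : p - q = (arc_eval d f - q) - (arc_eval d f - p) by ring.
exact: dvdp_sub.
Qed.

(** The restriction of f to the arc has order at least minn s d: at precision d,
    orders beyond d cannot be told apart. *)
Definition arc_order_ge d s f : Prop := exists2 p, arc_jet d f p & 'X^s %| p.

Lemma arc_order_ge_power d o (S : set (cvps n K)) :
  (forall f, S f -> arc_order_ge d o f) ->
  forall j f, ideal_power (ideal_span S) j f -> arc_order_ge d (j * o) f.
Proof.
have spanP s (T : set (cvps n K)) : (forall f, T f -> arc_order_ge d s f) ->
    forall f, ideal_span T f -> arc_order_ge d s f.
  move=> TP; apply: ideal_span_ind => //.
  - by exists 0; [exact: arc_jet0 | exact: dvdp0].
  - move=> f g [p fp sp] [q gq sq].
    by exists (p + q); [exact: arc_jetD | exact: dvdp_add].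
  - move=> f g [q gq sq]; exists (arc_eval d f * q); last exact: dvdp_mull.
    exact: (arc_jetM (arc_jet_self d f)).
move=> SP j; apply: (spanP) => f [s [Is ->]].
elim: j s Is => [|j IHj] s Is.
  by rewrite big_ord0; exists 1; [exact: arc_jet1 | rewrite mul0n expr0 dvd1p].
rewrite big_ord_recl mulSn.
have [p sp op] := spanP _ _ SP _ (Is ord0).
have [|q sq oq] := IHj (fun i => s (lift ord0 i)); first by move=> i; exact: Is.
by exists (p * q); [exact: arc_jetM | rewrite exprD; exact: dvdp_mul].
Qed.

(** If e < o, the term b_j g^(k - j - 1) of an equation of integral dependence
    has order at least (j + 1) o + (k - j - 1) e > k e along the arc, so nothing
    cancels the term a^k t^(k e) of g^k. *)
Lemma arc_criterion (S : set (cvps n K)) g (a : K) (o e : nat) : a != 0 ->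
  (forall d, arc_jet d g (a *: 'X^e)) ->
  (forall d f, S f -> arc_order_ge d o f) ->
  ideal_integral_closure (ideal_span S) g -> (o <= e)%N.
Proof.
move=> a0 gP SP [k [b [k0 Ib E]]]; rewrite leqNgt; apply/negP => eo.
(* The precision at which the order of g^k is just visible. *)
pose d := (e * k).+1.
have gX l : arc_jet d (g ^+ l) (a ^+ l *: 'X^(e * l)).
  by rewrite exprM -exprZn; exact: arc_jetXn.
have [q bq dq] : arc_order_ge d d (\sum_(j < k) b j * g ^+ (k - j.+1)).
  apply: (big_ind (arc_order_ge d d)).
  - by exists 0; [exact: arc_jet0 | exact: dvdp0].
  - move=> f1 f2 [p1 fp1 dp1] [p2 fp2 dp2].
    by exists (p1 + p2); [exact: arc_jetD | exact: dvdp_add].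
  move=> [j jk] _ /=.
  have [p bp op] := arc_order_ge_power (SP d) (Ib (Ordinal jk)).
  exists (p * (a ^+ (k - j.+1) *: 'X^(e * (k - j.+1)))); first exact: arc_jetM.
  apply: (@dvdp_trans _ ('X^(j.+1 * o) * 'X^(e * (k - j.+1)))).
    rewrite -exprD dvdp_Pexp2l ?size_polyX //= /d.
    have -> : k = (j.+1 + (k - j.+1))%N by lia.
    by rewrite addKn; nia.
  by apply: dvdp_mul => //; rewrite -mul_polyC dvdp_mull.
have := arc_jet_uniq (arc_jetD (gX k) bq) _; rewrite E => /(_ _ (arc_jet0 d)).
rewrite subr0 dvdp_addl // -mul_polyC => /dvdp_leq.
rewrite mulf_neq0 ?polyC_eq0 ?expf_neq0 ?polyX_eq0 // => /(_ isT).
by rewrite mul_polyC size_scale ?expf_neq0 // !size_polyXn ltnn.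
Qed.

End Arcs.

(** * The toric hypersurface *)

Lemma primitive_root_exists (K : numClosedFieldType) n : (0 < n)%N ->
  exists z : K, n.-primitive_root z.
Proof.
move=> n0; have [r Dr] := closed_field_poly_normal ('X^n - 1 : {poly K}).
have lead1 : lead_coef ('X^n - 1 : {poly K}) = 1.
  by apply/monicP; rewrite monicXnsubC.
rewrite lead1 scale1r in Dr.
have /hasP[z _ zn] : has n.-primitive_root r.
  apply: has_prim_root => //.
  - by apply/allP => z; rewrite -root_prod_XsubC -Dr.
  - by rewrite -separable_prod_XsubC -Dr separable_Xn_sub_1 // pnatr_eq0 -lt0n.
  - by rewrite -ltnS -(size_prod_XsubC r id) -Dr size_XnsubC.
by exists z.
Qed.

Section Toric.
Variables (K : numFieldType) (alpha beta N : nat).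
Implicit Types (a b : nat).

Local Notation u := (@cvpsX 2 K ord0).
Local Notation v := (@cvpsX 2 K ord_max).
Local Notation x1 := (@cvpsX (2 + 2) K (lshift 2 ord0)).
Local Notation x2 := (@cvpsX (2 + 2) K (lshift 2 ord_max)).
Local Notation y1 := (@cvpsX (2 + 2) K (rshift 2 ord0)).
Local Notation y2 := (@cvpsX (2 + 2) K (rshift 2 ord_max)).

Lemma rename_uv p (sigma : 'I_2 -> 'I_p) (inj : injective sigma) a b :
  cvps_rename inj (u ^+ a * v ^+ b) =
  cvpsX (sigma ord0) ^+ a * cvpsX (sigma ord_max) ^+ b.
Proof.
have max1 : lift ord0 ord0 = ord_max :> 'I_2 by exact: val_inj.
have := cvps_rename_monomial K inj (fun i => if i == ord0 then a else b).
by rewrite !big_ord_recl !big_ord0 max1 /= !mulr1.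
Qed.

Definition uv_difference a b : cvps (2 + 2) K :=
  x1 ^+ a * x2 ^+ b - y1 ^+ a * y2 ^+ b.

Lemma uv_differenceE a b :
  in_x (u ^+ a * v ^+ b) - in_y (u ^+ a * v ^+ b) = uv_difference a b.
Proof. by rewrite /in_x /in_y !rename_uv. Qed.

Definition toric_generators : set (cvps (2 + 2) K) := fun f =>
  [\/ f = uv_difference 1 0, f = uv_difference alpha beta
    | f = uv_difference 0 N].

Lemma toric_diagonal_ideal :
  diagonal_ideal (toric_normalization K alpha beta N) =
  ideal_span toric_generators.
Proof.
congr ideal_span; apply/funext => f; apply/propext.
have u1 : u = u ^+ 1 * v ^+ 0 by rewrite expr1 mulr1.
have vN : v ^+ N = u ^+ 0 * v ^+ N by rewrite mul1r.
split=> [[[[|[|[|//]]] i3] ->]|[] ->].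
- by apply: Or31; rewrite /tnth /= u1 uv_differenceE.
- by apply: Or32; rewrite /tnth /= uv_differenceE.
- by apply: Or33; rewrite /tnth /= vN uv_differenceE.
- by exists ord0; rewrite -uv_differenceE -u1.
- by exists (inord 1); rewrite -uv_differenceE (tnth_nth 0) inordK.
- by exists (inord 2); rewrite -uv_differenceE (tnth_nth 0) inordK // -vN.
Qed.

(** [arc_criterion] on the arc x1 = y1 = t^q, x2 = t^p, y2 = z t^p, where the
    difference of exponents (a, b) is (1 - z^b) t^(q a + p b).  The two
    disjunctions say that the last two generators have order at least o. *)
Lemma toric_arc (z : K) (p q o a b : nat) : (0 < p)%N -> (0 < q)%N ->
  z ^+ b != 1 ->
  (z ^+ beta = 1 \/ (o <= q * alpha + p * beta)%N) ->
  (z ^+ N = 1 \/ (o <= p * N)%N) ->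
  lipschitz_saturation (toric_normalization K alpha beta N) (u ^+ a * v ^+ b) ->
  (o <= q * a + p * b)%N.
Proof.
move=> p0 q0 zb Hbeta HN; rewrite /lipschitz_saturation /= uv_differenceE.
rewrite toric_diagonal_ideal.
pose c (i : 'I_(2 + 2)) : K :=
  match split i with inl _ => 1 | inr j => if j == ord0 then 1 else z end.
pose w (i : 'I_(2 + 2)) : nat :=
  match split i with inl j | inr j => if j == ord0 then q else p end.
have w0 i : (0 < w i)%N by rewrite /w; case: (split i) => j; case: (j == _).
have cl j : c (lshift 2 j) = 1 by rewrite /c (unsplitK (inl j)).
have cr j : c (rshift 2 j) = if j == ord0 then 1 else z.
  by rewrite /c (unsplitK (inr j)).
have wl j : w (lshift 2 j) = if j == ord0 then q else p.
  by rewrite /w (unsplitK (inl j)).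
have wr j : w (rshift 2 j) = if j == ord0 then q else p.
  by rewrite /w (unsplitK (inr j)).
have jet d a' b' : arc_jet c w d (uv_difference a' b')
    ((1 - z ^+ b') *: 'X^(q * a' + p * b')).
  rewrite scalerBl scale1r; apply: arc_jetD => //.
    have := arc_jetM w0 (arc_jetXn w0 a' (arc_jetX c w0 d (lshift 2 ord0)))
      (arc_jetXn w0 b' (arc_jetX c w0 d (lshift 2 ord_max))).
    by rewrite !cl !wl !scale1r -!exprM -exprD.
  apply: arc_jetN.
  have := arc_jetM w0 (arc_jetXn w0 a' (arc_jetX c w0 d (rshift 2 ord0)))
    (arc_jetXn w0 b' (arc_jetX c w0 d (rshift 2 ord_max))).
  by rewrite !cr !wr /= scale1r exprZn -!exprM -scalerAr -exprD.
apply: (arc_criterion (c := c) w0 (a := 1 - z ^+ b)) => //.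
  by rewrite subr_eq0 eq_sym.
move=> d f [] ->.
- exists 0; last exact: dvdp0.
  by have := jet d 1 0; rewrite expr0 subrr scale0r.
- exists ((1 - z ^+ beta) *: 'X^(q * alpha + p * beta)) => //.
  case: Hbeta => [->|le]; first by rewrite subrr scale0r dvdp0.
  by rewrite -mul_polyC dvdp_mull // dvdp_Pexp2l ?size_polyX.
exists ((1 - z ^+ N) *: 'X^(q * 0 + p * N)) => //.
case: HN => [->|le]; first by rewrite subrr scale0r dvdp0.
by rewrite muln0 add0n -mul_polyC dvdp_mull // dvdp_Pexp2l ?size_polyX.
Qed.

(** Everything reduces to x1^a D b, since the difference of the two copies of
    u^a v^b is x1^a D b up to a multiple of x1^a - y1^a. *)
Lemma toric_saturation_sufficient a b : coprime beta N ->
  (N %| b)%N \/ [/\ (alpha <= a)%N, (0 < b)%N &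
                   (beta %| b)%N \/ (N <= b)%N && (beta <= b)%N] ->
  lipschitz_saturation (toric_normalization K alpha beta N) (u ^+ a * v ^+ b).
Proof.
move=> cop Hab; rewrite /lipschitz_saturation /= uv_differenceE.
rewrite toric_diagonal_ideal.
set I := ideal_span toric_generators.
have I1 : I (x1 - y1).
  apply: ideal_span_sub; apply: Or31.
  by rewrite /uv_difference !expr0 !expr1 !mulr1.
have IX k : I (x1 ^+ k - y1 ^+ k).
  by rewrite subrXX; exact: ideal_spanMr.
have IN : I (x2 ^+ N - y2 ^+ N).
  by apply: ideal_span_sub; apply: Or33; rewrite /uv_difference !expr0 !mul1r.
have Ibeta k : (alpha <= k)%N -> I (x1 ^+ k * (x2 ^+ beta - y2 ^+ beta)).
  move=> /subnK <-; rewrite exprD -mulrA; apply: ideal_spanM.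
  have -> : x1 ^+ alpha * (x2 ^+ beta - y2 ^+ beta) =
    uv_difference alpha beta - y2 ^+ beta * (x1 ^+ alpha - y1 ^+ alpha).
    by rewrite /uv_difference; ring.
  apply: ideal_spanD; first by apply: ideal_span_sub; exact: Or32.
  exact/ideal_spanN/ideal_spanM/IX.
have split_diff : uv_difference a b =
    x1 ^+ a * (x2 ^+ b - y2 ^+ b) + y2 ^+ b * (x1 ^+ a - y1 ^+ a).
  by rewrite /uv_difference; ring.
have dvd_diff k m : (k %| m)%N ->
    exists h, x2 ^+ m - y2 ^+ m = h * (x2 ^+ k - y2 ^+ k).
  by move=> /dvdnP[l ->]; rewrite mulnC !exprM subrXX mulrC; eexists.
have in_ideal : I (x1 ^+ a * (x2 ^+ b - y2 ^+ b)) ->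
    ideal_integral_closure I (uv_difference a b).
  move=> Ib; apply: integral_closure_ideal; rewrite split_diff.
  by apply/ideal_spanN/ideal_spanD => //; exact/ideal_spanM/IX.
case: Hab => [Nb|[alpha_a b0 [betab|/andP[Nb betab]]]].
- apply: in_ideal; apply: ideal_spanM.
  by have [h ->] := dvd_diff N b Nb; exact/ideal_spanM/IN.
- apply: in_ideal; have [h ->] := dvd_diff beta b betab.
  by rewrite mulrCA; apply: ideal_spanM; exact: Ibeta.
rewrite split_diff; apply: (integral_difference cop) => //.
- exact: cvpsX_lreg.
- exact: Ibeta.
- exact/ideal_spanM/IN.
- exact/ideal_spanM/IX.
Qed.

End Toric.

Theorem theorem4p5 (R : realType) (alpha beta N : nat)
    (alpha_ge1 : (1 <= alpha)%N) (beta_ge1 : (1 <= beta)%N) (N_ge1 : (1 <= N)%N)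
    (beta_N_coprime : coprime beta N) (a b : nat) :
  lipschitz_saturation (toric_normalization R[i] alpha beta N)
    (cvpsX ord0 ^+ a * cvpsX ord_max ^+ b) <->
  ((exists m : nat, b = (m * N)%N) \/
   ((alpha <= a)%N /\ semigroup_saturation (semigroup_gen2 N beta) b)).
Proof.
have dvdE : (exists m, b = (m * N)%N) <-> (N %| b)%N.
  by split=> [/dvdnP|] // /dvdnP.
rewrite dvdE saturation_gen2 1?coprime_sym //.
split=> [sat|Hab].
  have [Nb|Nb] := boolP (N %| b)%N; [by left | right].
  have [z zN] := primitive_root_exists R[i] N_ge1.
  have zb : z ^+ b != 1 by rewrite -(prim_order_dvd zN).
  have arc p q : (0 < p)%N -> (0 < q)%N ->
      (q * alpha + p * beta <= q * a + p * b)%N.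
    move=> p0 q0; apply: (toric_arc p0 q0 zb _ _ sat); first by right.
    by left; exact: prim_expr_order zN.
  have alpha_a : (alpha <= a)%N.
    (* Large q makes the exponents of x1 decide. *)
    by have := arc 1%N b.+1 isT isT; nia.
  have beta_b : (beta <= b)%N.
    (* Large p makes the exponents of x2 decide. *)
    by have := arc a.+1 1%N isT isT; nia.
  split=> //; have [betab|betab] := boolP (beta %| b)%N.
    by case: (leqP N beta) => // _; rewrite ?beta_b ?orbT // betab.
  have [y ybeta] := primitive_root_exists R[i] beta_ge1.
  have yb : y ^+ b != 1 by rewrite -(prim_order_dvd ybeta).
  have arc' p : (0 < p)%N -> (p * N <= 1 * a + p * b)%N.
    move=> p0; apply: (toric_arc p0 _ yb _ _ sat) => //; last by right.
    by left; exact: prim_expr_order ybeta.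
  have N_b : (N <= b)%N by have := arc' a.+1 isT; nia.
  by rewrite geq_max N_b beta_b orbT.
apply: toric_saturation_sufficient => //.
case: Hab => [Nb|[alpha_a Sb]]; first by left.
have [Nb|Nb] := boolP (N %| b)%N; [by left | right].
have b0 : (0 < b)%N by rewrite lt0n; apply: contraNneq Nb => ->; rewrite dvdn0.
split=> //; case/orP: Sb => [|]; last by rewrite geq_max; right.
by case: (leqP N beta) => _ db; [rewrite db in Nb | left].
Qed.
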